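(* Let $X_1,\dots,X_n\in\mathbb{R}^p$ be i.i.d. random vectors satisfying the standing assumptions listed in the context. Let $D$ be a deterministic $n\times n$ diagonal matrix with positive diagonal entries $R_1,\dots,R_n$, and let $A$ be a deterministic positive definite $p\times p$ matrix with $A\succeq t\,\mathrm{Id}_p$ for some $t>0$. For a deterministic vector $\alpha\in\mathbb{R}^n$ with $\|\alpha\|=1$ let $$g(\alpha;X)=\alpha^\top\frac{DX}{\sqrt n}\left(\frac{X^\top D^2X}{n}+A\right)^{-1}\frac{X^\top D}{\sqrt n}\alpha .$$ Then, for a certain numerical constant $K$, $$\mathrm{var}\big(g(\alpha;X)\big)\le K\sum_{i=1}^n\left[\left(\alpha_i^4\frac{R_i^4}{n}\frac{b_{Q_2}(2;X_i)}{nt^2}+\frac{R_i^4}{n^2}b_L(4;X_i)\frac1{t^2}+\alpha_i^2\frac{R_i^2}{n}\frac{b_L(2;X_i)}{t}\right)\wedge1\right].$$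
   Context: Notation: $X$ is the $n\times p$ matrix whose $i$-th row is $X_i^\top$. $a\wedge b=\min(a,b)$; $\succeq$ is the Loewner order; $\|\cdot\|_{op}$ is the operator norm; $\|\alpha\|$ is the Euclidean norm. Standing assumptions: the ratio $p/n$ stays bounded away from $0$ and $\infty$; the $X_j$ are independent with mean $0$ and covariance $\Sigma_j$. For $k\ge1$, $b_L(k;X_j)$ and $b_{Q_2}(k;X_j)$ are deterministic numbers (finite for the exponents that appear) such that $\mathbb{E}|X_j^\top v|^k\le b_L(k;X_j)$ for every deterministic unit vector $v$, and $\mathbb{E}|X_j^\top MX_j-\mathbb{E}[X_j^\top MX_j]|^k\le b_{Q_2}(k;X_j)$ for every deterministic positive semidefinite $M$ with $\|M\|_{op}\le1$. Without loss of generality $b_L(k;X_j)\le\sqrt{b_L(2k;X_j)}$. *)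

(* Defs.v *)
From HB Require Import structures.
From mathcomp Require Import all_boot all_order all_algebra.
From mathcomp Require Import all_classical all_reals all_analysis.

Set Implicit Arguments.
Unset Strict Implicit.
Unset Printing Implicit Defensive.

Import Order.TTheory GRing.Theory Num.Theory.

Local Open Scope classical_set_scope.
Local Open Scope ring_scope.

(** ** Linear algebra *)

(* Euclidean norm; the library norm on ['cV[R]_m] is the sup norm. *)
Definition enorm (R : realType) (m : nat) (v : 'cV[R]_m) : R :=
  Num.sqrt (\sum_i v i 0 ^+ 2).

(* [u^T M v] as a scalar. *)
Definition bform (R : realType) (m : nat) (u : 'cV[R]_m) (M : 'M[R]_m)
    (v : 'cV[R]_m) : R := (u^T *m M *m v) 0 0.

Definition opnorm (R : realType) (m : nat) (M : 'M[R]_m) : R :=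
  sup [set enorm (M *m v) | v in [set v : 'cV[R]_m | enorm v <= 1]].

Definition psdmx (R : realType) (m : nat) (M : 'M[R]_m) : Prop :=
  M^T = M /\ forall v : 'cV[R]_m, 0 <= bform v M v.

Definition pdmx (R : realType) (m : nat) (M : 'M[R]_m) : Prop :=
  M^T = M /\ forall v : 'cV[R]_m, v != 0 -> 0 < bform v M v.

Definition loewner_le (R : realType) (m : nat) (M N : 'M[R]_m) : Prop :=
  psdmx (N - M).

(** ** Random vectors

  A random vector of R^p is a measurable map to [p.-tuple (measurableTypeR R)],
  which carries the product of the Borel sigma-algebras. *)

Definition colvec (R : realType) (p : nat) (x : p.-tuple (measurableTypeR R)) :
  'cV[R]_p := \col_j tnth x j.

Definition datamx (R : realType) (n p : nat)
    (x : 'I_n -> p.-tuple (measurableTypeR R)) : 'M[R]_(n, p) :=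
  \matrix_(i, j) tnth (x i) j.

Definition independent_family (R : realType) (d d' : measure_display)
    (T : measurableType d) (P : probability T R) (T' : measurableType d')
    (n : nat) (X : 'I_n -> {RV P >-> T'}) : Prop :=
  forall (J : {set 'I_n}) (B : 'I_n -> set T'),
    (forall i, measurable (B i)) ->
    P (\bigcap_(i in [set` J]) (X i @^-1` B i)) =
      (\prod_(i in J) P (X i @^-1` B i))%E.

Definition identically_distributed (R : realType) (d d' : measure_display)
    (T : measurableType d) (P : probability T R) (T' : measurableType d')
    (n : nat) (X : 'I_n -> {RV P >-> T'}) : Prop :=
  forall (i j : 'I_n) (B : set T'), measurable B ->
    distribution P (X i) B = distribution P (X j) B.

(* The L^2 requirement is what makes the mean and the covariance matrix
   well defined: the library integral is total. *)
Definition centered_with_cov (R : realType) (d : measure_display)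
    (T : measurableType d) (P : probability T R) (p : nat)
    (Y : {RV P >-> p.-tuple (measurableTypeR R)}) (Sigma : 'M[R]_p) : Prop :=
  [/\ forall a : 'I_p, (fun w => tnth (Y w) a) \in Lfun P 2%:E,
      forall a : 'I_p, ('E_P[fun w => tnth (Y w) a] = 0)%E
    & forall a b : 'I_p,
        covariance P (fun w => tnth (Y w) a) (fun w => tnth (Y w) b) =
          (Sigma a b)%:E].

(** ** Moment bounds for linear and quadratic forms

  The bounds are extended reals, since they are only required to be finite at
  the exponents that are used. *)

Definition linear_moment_bound (R : realType) (d : measure_display)
    (T : measurableType d) (P : probability T R) (p : nat)
    (Y : {RV P >-> p.-tuple (measurableTypeR R)}) (bL : nat -> \bar R) : Prop :=
  forall k : nat, (1 <= k)%N -> forall v : 'cV[R]_p, enorm v = 1 ->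
    ('E_P[(fun w => `|((colvec (Y w))^T *m v) 0 0| ^+ k)%R] <= bL k)%E.

Definition quadratic_moment_bound (R : realType) (d : measure_display)
    (T : measurableType d) (P : probability T R) (p : nat)
    (Y : {RV P >-> p.-tuple (measurableTypeR R)}) (bQ : nat -> \bar R) : Prop :=
  forall k : nat, (1 <= k)%N ->
  forall M : 'M[R]_p, psdmx M -> opnorm M <= 1 ->
    let q := fun w => bform (colvec (Y w)) M (colvec (Y w)) in
    ('E_P[(fun w => `|q w - fine 'E_P[q]%E| ^+ k)%R] <= bQ k)%E.

(** ** The statistic *)

Definition gstat (R : realType) (n p : nat) (D : 'M[R]_n) (A : 'M[R]_p)
    (alpha : 'cV[R]_n) (X : 'M[R]_(n, p)) : R :=
  let DX := (Num.sqrt n%:R)^-1 *: (D *m X) in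
  let S := n%:R^-1 *: (X^T *m (D *m D) *m X) + A in
  (alpha^T *m DX *m invmx S *m ((Num.sqrt n%:R)^-1 *: (X^T *m D)) *m alpha) 0 0.

(* Main.v *)
Require Import Defs.
From HB Require Import structures.
From mathcomp Require Import all_boot all_order all_algebra.
From mathcomp Require Import all_classical all_reals all_analysis.
From mathcomp Require Import measurable_realfun ring lra.

(** The variance is bounded by the Efron-Stein inequality, so it suffices to
  approximate the statistic, for each [k] and with the other observations fixed,
  by a constant with small mean squared error.

  Write [Y = D X / sqrt n] and [g = (Y^T a)^T (Y^T Y + A)^-1 (Y^T a)]. Let [Y0] be
  [Y] with its row [k] set to zero, let [S0 = Y0^T Y0 + A], and let [x] be the
  removed row, a multiple of [X_k]. Since [Y^T Y + A = S0 + x x^T] and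
  [Y^T a = Y0^T a + a_k x], the Sherman-Morrison formula
  ([gform_rank_one_update]) gives
  [[
    g = g0 + (2 a_k b + a_k^2 c - b^2) / (1 + c),
    b = x^T S0^-1 Y0^T a,    c = x^T S0^-1 x,
  ]]
  where [g0] is the statistic of [Y0]. Replacing [c] by its mean [c0] and [b] by
  [0] gives a constant with squared error at most
  [3 (a_k^4 (c - c0)^2 + 4 a_k^2 b^2 + b^4)] ([update_deviation]). The mean of the
  first term is a variance of a quadratic form, with [t S0^-1] positive
  semidefinite of operator norm at most [1]. The other two are moments of the
  linear form in the direction [u = S0^-1 Y0^T a], whose length satisfies
  [t |u|^2 <= g0 <= |a|^2 = 1] ([resolvent_sqr_le], [gform_le]). The three terms
  of the bound follow ([row_resampling_moment]). The minimum with [1] comes from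
  [0 <= g <= 1]: the constant [0] is also an approximation, with error at
  most [1].

  The Efron-Stein inequality ([efron_stein]) is derived for a law [Q] of
  independent coordinates by exchanging coordinates between two independent
  copies, an operation that preserves the product of [Q] with itself
  ([swap_coord_measure]). Conditional means given all the coordinates but one are
  partial integrals of this product. *)

Set Implicit Arguments.
Unset Strict Implicit.
Unset Printing Implicit Defensive.

Import Order.TTheory GRing.Theory Num.Theory.

Local Open Scope classical_set_scope.
Local Open Scope ring_scope.

(** * Resolvents and rank one updates *)

Section Dot.
Variable R : realType.

Definition dot (m : nat) (u v : 'cV[R]_m) : R := (u^T *m v) 0 0.

Lemma dotE m (u v : 'cV[R]_m) : dot u v = \sum_i u i 0 * v i 0.
Proof. by rewrite /dot mxE; apply: eq_bigr => i _; rewrite mxE. Qed.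

Lemma tr_mul_dot m (u v : 'cV[R]_m) : u^T *m v = (dot u v)%:M.
Proof. exact: mx11_scalar. Qed.

Lemma dot_delta m (k : 'I_m) (v : 'cV[R]_m) : dot (delta_mx k 0) v = v k 0.
Proof.
rewrite dotE (bigD1 k)//= big1 => [|i /negPf ik]; last first.
  by rewrite mxE ik mul0r.
by rewrite mxE !eqxx mul1r addr0.
Qed.

Lemma dotC m (u v : 'cV[R]_m) : dot u v = dot v u.
Proof. by rewrite !dotE; apply: eq_bigr => i _; rewrite mulrC. Qed.

Lemma dotDl m (u v w : 'cV[R]_m) : dot (u + v) w = dot u w + dot v w.
Proof. by rewrite /dot linearD mulmxDl mxE. Qed.

Lemma dotDr m (u v w : 'cV[R]_m) : dot u (v + w) = dot u v + dot u w.
Proof. by rewrite dotC dotDl !(dotC u). Qed.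

Lemma dotZl m a (u w : 'cV[R]_m) : dot (a *: u) w = a * dot u w.
Proof. by rewrite /dot linearZ /= -scalemxAl mxE. Qed.

Lemma dotZr m a (u w : 'cV[R]_m) : dot u (a *: w) = a * dot u w.
Proof. by rewrite dotC dotZl dotC. Qed.

Lemma dotNr m (u v : 'cV[R]_m) : dot u (- v) = - dot u v.
Proof. by rewrite /dot mulmxN mxE. Qed.

Lemma dotNl m (u v : 'cV[R]_m) : dot (- u) v = - dot u v.
Proof. by rewrite dotC dotNr dotC. Qed.

Lemma dot_ge0 m (u : 'cV[R]_m) : 0 <= dot u u.
Proof. by rewrite dotE; apply: sumr_ge0 => i _; rewrite -expr2 sqr_ge0. Qed.

Lemma dot_mulmxr m k (u : 'cV[R]_m) (M : 'M[R]_(m, k)) (v : 'cV[R]_k) :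
  dot u (M *m v) = dot (M^T *m u) v.
Proof. by rewrite /dot trmx_mul trmxK mulmxA. Qed.

Lemma enorm_sqr m (v : 'cV[R]_m) : enorm v ^+ 2 = dot v v.
Proof.
rewrite /enorm sqr_sqrtr.
  by rewrite dotE; apply: eq_bigr => i _; rewrite expr2.
by apply: sumr_ge0 => i _; rewrite sqr_ge0.
Qed.

Lemma enorm_ge0 m (v : 'cV[R]_m) : 0 <= enorm v.
Proof. exact: sqrtr_ge0. Qed.

Lemma enorm_eq0 m (v : 'cV[R]_m) : enorm v = 0 -> v = 0.
Proof.
move=> v0; have := enorm_sqr v; rewrite v0 expr0n /= dotE => /esym/eqP.
rewrite psumr_eq0 => [/allP h|i _]; last by rewrite -expr2 sqr_ge0.
apply/matrixP => i j; rewrite (ord1 j) mxE.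
by apply/eqP; have := h i (mem_index_enum _); rewrite mulf_eq0 orbb.
Qed.

Lemma bformE m (u v : 'cV[R]_m) M : bform u M v = dot u (M *m v).
Proof. by rewrite /bform /dot mulmxA. Qed.

Lemma loewner_scalar_le m t (S : 'M[R]_m) : loewner_le t%:M S ->
  forall v, t * dot v v <= bform v S v.
Proof.
move=> [_ h] v; have := h v; rewrite !bformE mulmxBl mul_scalar_mx.
by rewrite dotDr dotNr dotZr subr_ge0.
Qed.

(** A nonzero vector of the kernel would annihilate the quadratic form. *)
Lemma pdmx_unit m (S : 'M[R]_m) : pdmx S -> S \in unitmx.
Proof.
move=> [Ssym Spos]; rewrite -row_free_unit -kermx_eq0.
apply/rowV0P => u /sub_kermxP uS; apply/eqP; apply: contraT => u0.
have : 0 < bform u^T S u^T.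
  by apply: Spos; apply: contra u0 => /eqP u0; rewrite -[u]trmxK u0 trmx0.
by rewrite /bform trmxK uS mul0mx mxE ltxx.
Qed.

Lemma pd_inv_sym m (S : 'M[R]_m) : pdmx S -> (invmx S)^T = invmx S.
Proof. by move=> [Ssym _]; rewrite trmx_inv Ssym. Qed.

Lemma bform_invmx m (S : 'M[R]_m) v : pdmx S ->
  bform v (invmx S) v = bform (invmx S *m v) S (invmx S *m v).
Proof.
move=> pdS; rewrite !bformE [in RHS]mulmxA mulmxV ?pdmx_unit// mul1mx.
by rewrite dot_mulmxr pd_inv_sym.
Qed.

Section Resolvent.
Variables (m : nat) (S : 'M[R]_m) (t : R).
Hypotheses (pdS : pdmx S) (t0 : 0 < t).
Hypothesis leS : forall v, t * dot v v <= bform v S v.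

Lemma resolvent_ge0 v : 0 <= bform v (invmx S) v.
Proof.
rewrite bform_invmx//; apply: le_trans (leS _).
by rewrite mulr_ge0 ?dot_ge0// ltW.
Qed.

Lemma resolvent_sqr_le v :
  t * dot (invmx S *m v) (invmx S *m v) <= bform v (invmx S) v.
Proof. by rewrite bform_invmx// leS. Qed.

Lemma psdmx_scaled_resolvent : psdmx (t *: invmx S).
Proof.
split=> [|v]; first by rewrite linearZ /= pd_inv_sym.
rewrite bformE -scalemxAl dotZr -bformE.
by rewrite mulr_ge0 ?resolvent_ge0// ltW.
Qed.

(** This makes [t *: invmx S] an admissible matrix in the definition of the
  bound on quadratic forms, and [t^-1] the scale of the resolvent. *)
Lemma opnorm_scaled_resolvent : opnorm (t *: invmx S) <= 1.
Proof.
apply: ge_sup.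
  exists (enorm ((t *: invmx S) *m (0 : 'cV[R]_m))), 0 => //=.
  rewrite /enorm big1 ?sqrtr0// => i _.
  by rewrite mxE expr0n.
move=> _ [v /= v1 <-].
rewrite -(@expr_le1 _ 2%N) ?enorm_ge0// enorm_sqr -scalemxAl.
have : enorm v ^+ 2 <= 1 by rewrite expr_le1// enorm_ge0.
rewrite enorm_sqr; apply: le_trans.
set u := invmx S *m v.
have h1 : t * dot u u <= dot u v.
  by have := resolvent_sqr_le v; rewrite bformE (dotC v).
(* [2 t <u, v> <= |v|^2 + t^2 |u|^2] turns [h1] into [t^2 |u|^2 <= |v|^2] *)
have h2 : 0 <= dot (v - t *: u) (v - t *: u) by exact: dot_ge0.
move: h2; rewrite !(dotDl, dotDr, dotNl, dotNr, dotZl, dotZr) (dotC v u).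
have : t * (t * dot u u) <= t * dot u v by rewrite ler_pM2l.
lra.
Qed.

End Resolvent.

(** The Sherman-Morrison formula, applied to a vector. *)
Lemma invmx_rank_one_update m (S : 'M[R]_m) (x w : 'cV[R]_m) :
    S \in unitmx -> S + x *m x^T \in unitmx ->
    1 + bform x (invmx S) x != 0 ->
  invmx (S + x *m x^T) *m w = invmx S *m w -
    (dot x (invmx S *m w) / (1 + bform x (invmx S) x)) *: (invmx S *m x).
Proof.
move=> uS uSx c0; rewrite bformE in c0 *; set k := _ / _; set z := (X in _ = X).
suff h : (S + x *m x^T) *m z = w by rewrite -h mulKmx.
rewrite /z mulmxBr -scalemxAr !mulmxDl !(mulKVmx uS) -!mulmxA !tr_mul_dot.
rewrite !mul_mx_scalar -[X in _ - _ *: (X + _)]scale1r -scalerDl scalerA.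
by rewrite divfK// addrK.
Qed.

(** The statistic as a function of [Y = D X / sqrt n]. *)
Definition gform n p (A : 'M[R]_p) (Y : 'M[R]_(n, p)) (a : 'cV[R]_n) : R :=
  bform (Y^T *m a) (invmx (Y^T *m Y + A)) (Y^T *m a).

Section Gram.
Variables (n p : nat) (A : 'M[R]_p) (t : R).
Hypotheses (pdA : pdmx A) (t0 : 0 < t).
Hypothesis leA : forall v, t * dot v v <= bform v A v.
Implicit Type Y : 'M[R]_(n, p).

Lemma bform_gram Y v :
  bform v (Y^T *m Y + A) v = dot (Y *m v) (Y *m v) + bform v A v.
Proof. by rewrite !bformE mulmxDl dotDr -mulmxA dot_mulmxr trmxK. Qed.

Lemma gram_pd Y : pdmx (Y^T *m Y + A).
Proof.
case: pdA => symA posA; split=> [|v v0].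
  by rewrite linearD /= trmx_mul trmxK symA.
by rewrite bform_gram ltr_wpDl ?dot_ge0 ?posA.
Qed.

Lemma gram_ge Y v : t * dot v v <= bform v (Y^T *m Y + A) v.
Proof. by rewrite bform_gram (le_trans (leA v))// lerDr dot_ge0. Qed.

Lemma gform_ge0 Y a : 0 <= gform A Y a.
Proof. exact: (resolvent_ge0 (gram_pd Y) t0 (gram_ge Y)). Qed.

(** With [u] the resolvent applied to [v = Y^T a], the value [g = <a, Y u>] also
  equals [|Y u|^2 + u^T A u]. Hence [g = 2 g - g <= 2 <a, Y u> - |Y u|^2],
  which is [|a|^2 - |a - Y u|^2]. *)
Lemma gform_le Y a : gform A Y a <= dot a a.
Proof.
have pdS := gram_pd Y; rewrite /gform; set S := Y^T *m Y + A in pdS *.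
set v := Y^T *m a; set u := invmx S *m v.
have g1 : bform v (invmx S) v = dot (Y *m u) (Y *m u) + bform u A u.
  by rewrite bform_invmx// bform_gram.
have g2 : bform v (invmx S) v = dot a (Y *m u) by rewrite bformE [RHS]dot_mulmxr.
have A0 : 0 <= bform u A u.
  by apply: le_trans (leA u); rewrite mulr_ge0 ?dot_ge0 ?ltW.
have h : 0 <= dot (a - Y *m u) (a - Y *m u) by exact: dot_ge0.
move: h; rewrite !(dotDl, dotDr, dotNl, dotNr) (dotC _ a); lra.
Qed.

(** Adding the row [x] at the direction [e] moves [Y^T a] by [<e, a> x] and the
  Gram matrix by [x x^T]; Sherman-Morrison then gives the new value in closed
  form. The matrix [R0] and the vector [Y0^T a] do not involve [x], so as a
  function of [x] the increment depends only on a linear form [b] and a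
  quadratic form [c]. *)
Lemma gform_rank_one_update Y0 (e : 'cV[R]_n) (x : 'cV[R]_p) (a : 'cV[R]_n) :
    Y0^T *m e = 0 -> dot e e = 1 ->
  let R0 := invmx (Y0^T *m Y0 + A) in
  let ae := dot e a in
  let b := dot x (R0 *m (Y0^T *m a)) in
  let c := bform x R0 x in
  gform A (Y0 + e *m x^T) a =
    gform A Y0 a + (2 * ae * b + ae ^+ 2 * c - b ^+ 2) / (1 + c).
Proof.
move=> Y0e ee R0 ae b c.
have c0 : 0 <= c by exact: (resolvent_ge0 (gram_pd Y0) t0 (gram_ge Y0)).
have c1 : 1 + c != 0 by rewrite gt_eqF// ltr_pwDl.
have eY0 : e^T *m Y0 = 0 by rewrite -[LHS]trmxK trmx_mul trmxK Y0e trmx0.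
set Y := Y0 + _.
have wE : Y^T *m a = Y0^T *m a + ae *: x.
  rewrite /Y [(_ + _)^T]linearD /= trmx_mul trmxK mulmxDl -mulmxA tr_mul_dot.
  by rewrite mul_mx_scalar.
have SE : Y^T *m Y + A = (Y0^T *m Y0 + A) + x *m x^T.
  rewrite /Y [(_ + _)^T]linearD /= trmx_mul trmxK mulmxDl !mulmxDr (mulmxA _ e) Y0e mul0mx.
  rewrite addr0 -(mulmxA x) eY0 mulmx0 add0r -(mulmxA x) (mulmxA e^T) tr_mul_dot.
  by rewrite ee mul1mx addrAC.
have pdS0 := gram_pd Y0; have pdS := gram_pd Y.
have symR : forall u v, dot u (R0 *m v) = dot v (R0 *m u).
  by move=> u v; rewrite dot_mulmxr pd_inv_sym// dotC.
rewrite /gform bformE wE SE invmx_rank_one_update ?pdmx_unit -?SE//.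
rewrite -/R0 -/c [in RHS]bformE -/R0 dotDr dotNr dotZr.
move: c1; rewrite /b /c bformE; set v := Y0^T *m a => c1.
rewrite !(mulmxDr, dotDl, dotDr) -!scalemxAr !(dotZl, dotZr).
rewrite !(symR _ x).
by field.
Qed.

End Gram.
End Dot.

(** * Bounded measurable functions *)

(** Integrability, products and partial integrals are automatic in this class,
  and the statistic takes values in [[0, 1]]. *)
Definition bounded_measurable (R : realType) d (T : measurableType d)
    (f : T -> R) : Prop :=
  measurable_fun setT f /\ exists M : R, forall x, `|f x| <= M.

Section BoundedMeasurable.
Context (R : realType) d (T : measurableType d).
Implicit Types f g : T -> R.

Lemma bounded_measurable_cst (r : R) : bounded_measurable (fun _ : T => r).
Proof. by split; [exact: measurable_cst|exists `|r|]. Qed.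

Lemma bounded_measurableB f g : bounded_measurable f -> bounded_measurable g ->
  bounded_measurable (fun x => f x - g x).
Proof.
move=> [mf [M fM]] [mg [N gN]]; split; first exact: measurable_funB.
exists (M + N) => x; apply: le_trans (ler_normB _ _) _.
by rewrite lerD.
Qed.

Lemma bounded_measurableD f g : bounded_measurable f -> bounded_measurable g ->
  bounded_measurable (fun x => f x + g x).
Proof.
move=> [mf [M fM]] [mg [N gN]]; split; first exact: measurable_funD.
exists (M + N) => x; apply: le_trans (ler_normD _ _) _.
by rewrite lerD.
Qed.

Lemma bounded_measurableM f g : bounded_measurable f -> bounded_measurable g ->
  bounded_measurable (fun x => f x * g x).
Proof.
move=> [mf [M fM]] [mg [N gN]]; split; first exact: measurable_funM.
exists (M * N) => x; rewrite normrM.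
by rewrite ler_pM.
Qed.

Lemma bounded_measurableZ (r : R) f : bounded_measurable f ->
  bounded_measurable (fun x => r * f x).
Proof. exact/bounded_measurableM/bounded_measurable_cst. Qed.

Lemma bounded_measurableN f : bounded_measurable f ->
  bounded_measurable (fun x => - f x).
Proof.
move=> [mf [M fM]]; split; first exact: measurableT_comp.
by exists M => x; rewrite normrN.
Qed.

Lemma bounded_measurableX f k : bounded_measurable f ->
  bounded_measurable (fun x => f x ^+ k).
Proof.
move=> [mf [M fM]]; split; first exact: measurable_funX.
by exists (M ^+ k) => x; rewrite normrX lerXn2r ?nnegrE// (le_trans _ (fM x)).
Qed.

Lemma bounded_measurable_sum (I : Type) (s : seq I) (F : I -> T -> R) :
  (forall i, bounded_measurable (F i)) ->
  bounded_measurable (fun x => \sum_(i <- s) F i x).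
Proof.
move=> bF; elim: s => [|i s IH].
  by under eq_fun do rewrite big_nil; exact: bounded_measurable_cst.
by under eq_fun do rewrite big_cons; exact: bounded_measurableD.
Qed.

Variable P : probability T R.

Lemma bounded_measurable_integrable f : bounded_measurable f ->
  P.-integrable setT (EFin \o f).
Proof.
move=> [mf [M fM]]; apply: measurable_bounded_integrable => //.
- exact: fin_num_fun_lty.
- exists M; split; first exact: num_real.
  by move=> N MN x _; apply: le_trans (fM x) (ltW MN).
Qed.

Lemma Rintegral_const (r : R) : \int[P]_x r = r.
Proof.
rewrite Rintegral_cst// -[RHS]mulr1; congr (_ * _).
exact: (congr1 fine (probability_setT P)).
Qed.

Lemma Rintegral_sum (I : Type) (s : seq I) (F : I -> T -> R) :
  (forall i, bounded_measurable (F i)) ->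
  \int[P]_x (\sum_(i <- s) F i x) = \sum_(i <- s) \int[P]_x F i x.
Proof.
move=> bF; elim: s => [|i s IH].
  under eq_Rintegral do rewrite big_nil.
  by rewrite big_nil Rintegral_const.
under eq_Rintegral do rewrite big_cons.
rewrite big_cons RintegralD ?IH//; apply: bounded_measurable_integrable => //.
exact: bounded_measurable_sum.
Qed.

Lemma mean_minimizes_sqr_dev f h : bounded_measurable f ->
  \int[P]_x (f x - \int[P]_y f y) ^+ 2 <= \int[P]_x (f x - h) ^+ 2.
Proof.
move=> bf; set m := \int[P]_y f y.
have bc r : bounded_measurable (fun _ : T => r) := bounded_measurable_cst r.
have bdev r : bounded_measurable (fun x => (f x - r) ^+ 2).
  by apply: bounded_measurableX; exact: bounded_measurableB.
rewrite -subr_ge0 -RintegralB//; try exact: bounded_measurable_integrable.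
have -> : \int[P]_x ((f x - h) ^+ 2 - (f x - m) ^+ 2) =
    \int[P]_x (2 * (m - h) * f x + (h ^+ 2 - m ^+ 2)).
  by apply: eq_Rintegral => x _; ring.
rewrite RintegralD//; try apply: bounded_measurable_integrable => //; last first.
  exact: bounded_measurableZ.
rewrite Rintegral_const RintegralZl//; last exact: bounded_measurable_integrable.
rewrite -/m; have := sqr_ge0 (m - h); lra.
Qed.

End BoundedMeasurable.

Lemma bounded_measurable_comp (R : realType) d d' (T : measurableType d)
    (T' : measurableType d') (f : T' -> R) (g : T -> T') :
  bounded_measurable f -> measurable_fun setT g ->
  bounded_measurable (fun x => f (g x)).
Proof.
move=> [mf [M fM]] mg; split; first exact: measurableT_comp.
by exists M => x.
Qed.

Section PartialIntegral.
Context (R : realType) d d' (T : measurableType d) (T' : measurableType d').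
Variables (P : probability T R) (P' : probability T' R).
Variable f : T * T' -> R.
Hypothesis bf : bounded_measurable f.

Lemma Rintegral_prod :
  \int[(P \x P')%E]_z f z = \int[P]_x \int[P']_y f (x, y).
Proof.
rewrite /Rintegral.
have := bounded_measurable_integrable (P \x P')%E bf => intf.
rewrite -(integral12_prod_meas1 intf) /fubini_F.
congr fine; apply: eq_integral => x _.
rewrite fineK//.
apply: integrable_fin_num => //.
apply: (@bounded_measurable_integrable _ _ _ _ (fun y => f (x, y))).
by apply: bounded_measurable_comp => //; exact: pair1_measurable.
Qed.

Lemma bounded_measurable_partial :
  bounded_measurable (fun x => \int[P']_y f (x, y)).
Proof.
have [mf [M fM]] := bf.
split.
  have mF := measurable_fubini_F (bounded_measurable_integrable (P \x P')%E bf).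
  exact: (measurableT_comp (fine_measurable measurableT) mF).
have bfx x : bounded_measurable (fun y => f (x, y)).
  by apply: bounded_measurable_comp => //; exact: pair1_measurable.
exists M => x; apply: le_trans (le_normr_Rintegral _ _) _ => //.
  exact: bounded_measurable_integrable.
apply: (@le_trans _ _ (\int[P']_y M)); last first.
  by rewrite Rintegral_const.
apply: le_Rintegral => //; apply: bounded_measurable_integrable.
  split; last by exists M => y; rewrite normr_id.
  by apply: measurableT_comp => //; case: (bfx x).
exact: bounded_measurable_cst.
Qed.

End PartialIntegral.

(** * Exchanging coordinates between two independent copies *)

Section Mix.
Context (T : Type) (n : nat).
Implicit Types (J : pred 'I_n) (x y z : n.-tuple T).

(** The tuple [x] in which the coordinates in [J] come from [y]. Resampling the
  coordinate [k] is [mix (pred1 k)]. *)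
Definition mix J x y : n.-tuple T :=
  [tuple if J i then tnth y i else tnth x i | i < n].

Lemma tnth_mix J x y i : tnth (mix J x y) i = if J i then tnth y i else tnth x i.
Proof. exact: tnth_mktuple. Qed.

Lemma mix0 J x y : J =1 xpred0 -> mix J x y = x.
Proof. by move=> J0; apply: eq_from_tnth => i; rewrite tnth_mix J0. Qed.

Lemma mixT J x y : J =1 xpredT -> mix J x y = y.
Proof. by move=> J1; apply: eq_from_tnth => i; rewrite tnth_mix J1. Qed.

(** Exchanging the coordinates in [J] between [x] and [y], and then mixing along
  [J'], amounts to mixing along the symmetric difference of [J] and [J']. *)
Lemma mix_mix J J' x y :
  mix J' (mix J x y) (mix J y x) = mix (fun i => J i (+) J' i) x y.
Proof.
by apply: eq_from_tnth => i; rewrite !tnth_mix; case: (J i); case: (J' i).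
Qed.

Lemma mix_mixl J x y z : mix J (mix J x y) z = mix J x z.
Proof. by apply: eq_from_tnth => i; rewrite !tnth_mix; case: (J i). Qed.

Lemma eq_mix J J' x y : J =1 J' -> mix J x y = mix J' x y.
Proof. by move=> JJ'; apply: eq_from_tnth => i; rewrite !tnth_mix JJ'. Qed.

End Mix.

Definition box (T : Type) (n : nat) (B : 'I_n -> set T) : set (n.-tuple T) :=
  [set x | forall i, B i (tnth x i)].

Section MixMeasurable.
Context d (V : measurableType d) (n : nat).

Lemma measurable_mix (J : pred 'I_n) d' (T : measurableType d')
    (f g : T -> n.-tuple V) :
  measurable_fun setT f -> measurable_fun setT g ->
  measurable_fun setT (fun w => mix J (f w) (g w)).
Proof.
move=> mf mg; apply/measurable_fun_tnthP => i.
have -> : (fun x => tnth x i) \o (fun w => mix J (f w) (g w)) =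
          (fun w => tnth (if J i then g w else f w) i).
  by apply/funext => w /=; rewrite tnth_mix; case: (J i).
by case: (J i); exact: (measurableT_comp (measurable_tnth i)).
Qed.

Lemma measurable_box (B : 'I_n -> set V) : (forall i, measurable (B i)) ->
  measurable (box B).
Proof.
move=> mB.
have -> : box B = \bigcap_(i in [set` finset.setT]) ((fun x => tnth x i) @^-1` B i).
  apply/seteqP; split=> x /= xB i; first by move=> _; exact: xB.
  by apply: xB; rewrite /= finset.in_setT.
apply: fin_bigcap_measurable; first exact: finite_finset.
move=> i _; rewrite -[X in measurable X]setTI.
exact: measurable_tnth.
Qed.

Lemma box_setI (B B' : 'I_n -> set V) :
  box B `&` box B' = box (fun i => B i `&` B' i).
Proof.
apply/seteqP; split=> x /=; first by move=> [xB xB'] i; split.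
by move=> xBB'; split=> i; have [] := xBB' i.
Qed.

(** Products of boxes form a pi-system, and they generate the product
  sigma-algebra because both projections, followed by any coordinate, are
  measurable for the sigma-algebra that they generate. *)
Lemma measure_eq_on_boxes (R : realType)
    (m1 m2 : {measure set (n.-tuple V * n.-tuple V) -> \bar R}) :
    (m1 setT < +oo)%E ->
    (forall B B', (forall i, measurable (B i)) -> (forall i, measurable (B' i)) ->
      m1 (box B `*` box B') = m2 (box B `*` box B')) ->
  forall A, measurable A -> m1 A = m2 A.
Proof.
move=> m1fin eqbox.
pose G := [set A : set (n.-tuple V * n.-tuple V) | exists B B',
  [/\ forall i, measurable (B i), forall i, measurable (B' i)
     & A = box B `*` box B']].
have boxT : box (fun _ : 'I_n => @setT V) = setT by apply/seteqP; split.
have GT : G setT.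
  by exists (fun=> setT), (fun=> setT); split=> //; rewrite boxT setXTT.
have Gm : G `<=` measurable.
  by move=> _ [B [B' [mB mB' ->]]]; apply: measurableX; exact: measurable_box.
have GI : setI_closed G.
  move=> _ _ [B [B' [mB mB' ->]]] [C [C' [mC mC' ->]]].
  exists (fun i => B i `&` C i), (fun i => B' i `&` C' i).
  split; try by move=> i; exact: measurableI.
  by rewrite -setXI !box_setI.
apply: (measure_unique G (fun=> setT)) => //.
- apply/seteqP; split; last exact: smallest_sub (@sigma_algebra_measurable _ _) Gm.
  pose Om := g_sigma_algebraType G.
  (* the identity is measurable from the sigma-algebra generated by boxes *)
  have mid : measurable_fun setT (id : Om -> (n.-tuple V * n.-tuple V)%type).
    apply/measurable_fun_pairP; split; apply/measurable_fun_tnthP => k _ Y mY;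
      rewrite setTI; apply: sub_sigma_algebra.
    + exists (fun i => if i == k then Y else setT), (fun=> setT); split=> //.
        by move=> i; case: ifP.
      rewrite boxT; apply/seteqP; split=> -[x y] /=.
        by move=> xY; split=> // i; case: eqP => [->|].
      by move=> [/(_ k)]; rewrite eqxx.
    + exists (fun=> setT), (fun i => if i == k then Y else setT); split=> //.
        by move=> i; case: ifP.
      rewrite boxT; apply/seteqP; split=> -[x y] /=.
        by move=> xY; split=> // i; case: eqP => [->|].
      by move=> [_ /(_ k)]; rewrite eqxx.
  by move=> A mA; have := mid measurableT A mA; rewrite setTI.
- by rewrite bigcup_const//; exists 0%N.
- move=> A [B [B' [mB mB' ->]]]; exact: eqbox.
Qed.

End MixMeasurable.

Section Swap.
Context (R : realType) d (V : measurableType d) (n : nat).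
Variable Q : probability (n.-tuple V) R.

(** [Q] is the product of its marginals. *)
Definition coord_independent :=
  forall B, (forall i, measurable (B i)) ->
    Q (box B) = (\prod_(i < n) Q [set x | B i (tnth x i)])%E.

Hypothesis indQ : coord_independent.

Let QQ : probability (n.-tuple V * n.-tuple V)%type R := (Q \x Q)%E.

Definition swap_coord (J : pred 'I_n) (z : n.-tuple V * n.-tuple V) :=
  (mix J z.1 z.2, mix J z.2 z.1).

Lemma measurable_swap_coord J : measurable_fun setT (swap_coord J).
Proof. by apply: measurable_fun_pair; apply: measurable_mix. Qed.

Lemma swap_coord_box J B B' :
  swap_coord J @^-1` (box B `*` box B') =
  box (fun i => if J i then B' i else B i) `*`
  box (fun i => if J i then B i else B' i).
Proof.
apply/seteqP; split=> -[x y] /= [xB yB]; split=> i; move: (xB i) (yB i);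
  rewrite !tnth_mix; by case: (J i).
Qed.

HB.instance Definition _ J :=
  isMeasurableFun.Build _ _ _ _ (swap_coord J) (measurable_swap_coord J).

Lemma QQ_box B B' :
    (forall i, measurable (B i)) -> (forall i, measurable (B' i)) ->
  QQ (box B `*` box B') = (\prod_(i < n)
    (Q [set x | B i (tnth x i)] * Q [set x | B' i (tnth x i)]))%E.
Proof.
move=> mB mB'.
rewrite big_split /= -!indQ//.
by apply: product_measure1E; exact: measurable_box.
Qed.

(** Two independent copies may exchange any set of coordinates: on a product of
  boxes both sides are the same product of marginal probabilities. *)
Lemma swap_coord_measure J A : measurable A ->
  distribution QQ (swap_coord J) A = QQ A.
Proof.
apply: measure_eq_on_boxes; first exact: fin_num_fun_lty.
move=> B B' mB mB'.
rewrite -[LHS]/(QQ (swap_coord J @^-1` (box B `*` box B'))) swap_coord_box.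
rewrite QQ_box; try by move=> i; case: ifP.
apply: etrans (esym (QQ_box mB mB')); apply: eq_bigr => i _.
by case: (J i) => //; rewrite muleC.
Qed.

Lemma Rintegral_swap J (G : n.-tuple V * n.-tuple V -> R) :
  bounded_measurable G ->
  \int[QQ]_z G (swap_coord J z) = \int[QQ]_z G z.
Proof.
move=> bG; rewrite /Rintegral; congr fine.
have law1 : (\int[distribution QQ (swap_coord J)]_z (G z)%:E =
    \int[QQ]_z (G (swap_coord J z))%:E)%E.
  rewrite integral_distribution//; first by apply/measurable_EFinP; exact: bG.1.
  apply: (@bounded_measurable_integrable _ _ _ _ (G \o swap_coord J)).
  exact: (bounded_measurable_comp bG (measurable_swap_coord J)).
have law2 : (\int[distribution QQ (swap_coord J)]_z (G z)%:E =
    \int[QQ]_z (G z)%:E)%E.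
  by apply: eq_measure_integral => A mA _; exact: swap_coord_measure.
exact: etrans (esym law1) law2.
Qed.

End Swap.

(** * The Efron-Stein inequality *)

Definition pair_integral (R : realType) d (T : measurableType d)
    (Q : probability T R) (G : T * T -> R) : R :=
  \int[(Q \x Q)%E]_z G z.

Definition below n (k : nat) : pred 'I_n := fun i => (i < k)%N.

Section EfronStein.
Context (R : realType) d (V : measurableType d) (n : nat).
Variable Q : probability (n.-tuple V) R.
Hypothesis indQ : coord_independent Q.
Variable f : n.-tuple V -> R.
Hypothesis bf : bounded_measurable f.

Local Notation int2 := (pair_integral Q).

Let bfst : bounded_measurable (fun z : n.-tuple V * n.-tuple V => f z.1).
Proof. by apply: (bounded_measurable_comp bf). Qed.

Let bsnd : bounded_measurable (fun z : n.-tuple V * n.-tuple V => f z.2).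
Proof. by apply: (bounded_measurable_comp bf). Qed.

Let bmix J :
  bounded_measurable (fun z : n.-tuple V * n.-tuple V => f (mix J z.1 z.2)).
Proof. by apply: (bounded_measurable_comp bf); exact: measurable_mix. Qed.

Let int2D G G' : bounded_measurable G -> bounded_measurable G' ->
  int2 (fun z => G z + G' z) = int2 G + int2 G'.
Proof.
by move=> bG bG'; rewrite /pair_integral RintegralD//;
  exact: (bounded_measurable_integrable (Q \x Q)%E).
Qed.

Let int2Z G r : bounded_measurable G -> int2 (fun z => r * G z) = r * int2 G.
Proof.
by move=> bG; rewrite /pair_integral RintegralZl//;
  exact: (bounded_measurable_integrable (Q \x Q)%E).
Qed.

Let int2_le G G' : bounded_measurable G -> bounded_measurable G' ->
  (forall z, G z <= G' z) -> int2 G <= int2 G'.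
Proof.
by move=> bG bG' le; apply: le_Rintegral => //;
  exact: (bounded_measurable_integrable (Q \x Q)%E).
Qed.

Let int2_swap J G : bounded_measurable G ->
  int2 G = int2 (fun z => G (mix J z.1 z.2, mix J z.2 z.1)).
Proof. by move=> bG; rewrite /pair_integral -(Rintegral_swap indQ J bG). Qed.

Definition resampling_gap (k : 'I_n) : R :=
  int2 (fun z => (f z.1 - f (mix (pred1 k) z.1 z.2)) ^+ 2).

Lemma variance_as_increment :
  \int[Q]_x f x ^+ 2 - (\int[Q]_x f x) ^+ 2 =
  int2 (fun z => f z.1 * (f z.1 - f z.2)).
Proof.
rewrite /pair_integral Rintegral_prod; last first.
  by apply: bounded_measurableM => //; exact: bounded_measurableB.
have iQ g : bounded_measurable g -> Q.-integrable setT (EFin \o g).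
  exact: bounded_measurable_integrable.
have -> : \int[Q]_x \int[Q]_y (f x * (f x - f y)) =
  \int[Q]_x (f x ^+ 2 - f x * \int[Q]_y f y).
  apply: eq_Rintegral => x _.
  rewrite RintegralZl//; last first.
    by apply: iQ; apply: bounded_measurableB => //; exact: bounded_measurable_cst.
  rewrite RintegralB//; try exact: iQ; last first.
    by apply: iQ; exact: bounded_measurable_cst.
  by rewrite Rintegral_const mulrBr expr2.
rewrite RintegralB//; [|by apply: iQ; exact: bounded_measurableX|].
  by rewrite RintegralZr ?expr2//; exact: iQ.
by apply: iQ; apply: bounded_measurableM => //; exact: bounded_measurable_cst.
Qed.

(** Exchanging the coordinate [k] changes the sign of the second factor and
  replaces [f x] by [f] at the resampled point. Averaging the two expressions
  turns the left-hand side into half the integral of a product of two resampling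
  differences at [k]; exchanging the coordinates below [k] shows that both have
  the same second moment. *)
Lemma increment_le_gap (k : 'I_n) :
  int2 (fun z => f z.1 * (f (mix (below k) z.1 z.2) - f (mix (below k.+1) z.1 z.2)))
  <= 2^-1 * resampling_gap k.
Proof.
set D := fun z : n.-tuple V * n.-tuple V =>
  f (mix (below k) z.1 z.2) - f (mix (below k.+1) z.1 z.2).
set G := fun z : n.-tuple V * n.-tuple V => f z.1 - f (mix (pred1 k) z.1 z.2).
have bD : bounded_measurable D by exact: bounded_measurableB.
have bG : bounded_measurable G by exact: bounded_measurableB.
set L := int2 _.
have belowS : below k.+1 =1 (fun i => pred1 k i (+) below k i).
  move=> i; rewrite /below /= ltnS leq_eqVlt -val_eqE /=.
  by case: eqP => [->|]; rewrite ?ltnn.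
have belowS' : below k =1 (fun i => pred1 k i (+) below k.+1 i).
  by move=> i; rewrite belowS addbA addbb.
(* exchanging the coordinate [k] turns [D] into [- D] *)
have L1 : L = int2 (fun z => f (mix (pred1 k) z.1 z.2) * (- D z)).
  rewrite /L (int2_swap (pred1 k)); last exact: bounded_measurableM.
  congr int2; apply/funext => z /=; congr (_ * _).
  rewrite /D /= !mix_mix opprB.
  by rewrite -(eq_mix _ _ belowS) -(eq_mix _ _ belowS').
have L2 : 2 * L = int2 (fun z => G z * D z).
  rewrite mulr_natl mulr2n {2}L1 /L -int2D//; last 2 first.
  - exact: bounded_measurableM.
  - apply: bounded_measurableM => //; exact: bounded_measurableN.
  by congr int2; apply/funext => z; rewrite /G mulrBl mulrN.
(* exchanging the coordinates below [k] turns [G] into [D] *)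
have D2 : int2 (fun z => D z ^+ 2) = resampling_gap k.
  rewrite /resampling_gap [RHS](int2_swap (below k)); last first.
    exact: bounded_measurableX.
  congr int2; apply/funext => z /=; rewrite /D mix_mix.
  by congr ((_ - f _) ^+ 2); apply: eq_mix => i; rewrite belowS addbC.
suff : 2 * L <= resampling_gap k by lra.
rewrite L2.
have -> : resampling_gap k =
    int2 (fun z => 2^-1 * G z ^+ 2 + 2^-1 * D z ^+ 2).
  rewrite int2D ?int2Z ?D2 -/(resampling_gap k); try exact: bounded_measurableX.
  - by rewrite /resampling_gap; lra.
  - by apply: bounded_measurableZ; exact: bounded_measurableX.
  - by apply: bounded_measurableZ; exact: bounded_measurableX.
apply: int2_le => [||z].
- exact: bounded_measurableM.
- by apply: bounded_measurableD; apply: bounded_measurableZ;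
    exact: bounded_measurableX.
- by have := sqr_ge0 (G z - D z); lra.
Qed.

(** With [y] an independent copy of [x], the variance is the mean of
  [f x * (f x - f y)]; the difference telescopes along the path from [x] to [y]
  that replaces the coordinates one at a time. *)
Theorem efron_stein :
  \int[Q]_x f x ^+ 2 - (\int[Q]_x f x) ^+ 2 <=
  2^-1 * \sum_(k < n) resampling_gap k.
Proof.
rewrite variance_as_increment mulr_sumr.
have -> : (fun z => f z.1 * (f z.1 - f z.2)) =
  (fun z : n.-tuple V * n.-tuple V => \sum_(k < n)
    f z.1 * (f (mix (below k) z.1 z.2) - f (mix (below k.+1) z.1 z.2))).
  apply/funext => z; rewrite -mulr_sumr; congr (_ * _).
  pose F i := f (mix (below i) z.1 z.2).
  rewrite -(big_mkord xpredT (fun i => F i - F i.+1)).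
  under eq_bigr do rewrite -opprB.
  rewrite sumrN telescope_sumr// opprB /F mix0// mixT// => i.
  by rewrite /below ltn_ord.
rewrite /pair_integral Rintegral_sum => [|k]; last first.
  by apply: bounded_measurableM => //; exact: bounded_measurableB.
by apply: ler_sum => k _; exact: increment_le_gap.
Qed.

(** The best choice of [h] is the mean [m x] over the coordinate [k], and [m] does
  not depend on this coordinate. So [f x - m x] and [f (mix (pred1 k) x y) - m x]
  have the same second moment, and it is at most [b]; the factor [4] comes from
  the squared triangle inequality. *)
Lemma resampling_gap_le (k : 'I_n) (b : R) :
    (forall x, exists h, \int[Q]_y (f (mix (pred1 k) x y) - h) ^+ 2 <= b) ->
  resampling_gap k <= 4 * b.
Proof.
move=> hb.
set F := fun z : n.-tuple V * n.-tuple V => f (mix (pred1 k) z.1 z.2).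
have bF : bounded_measurable F by exact: bmix.
pose m x := \int[Q]_y F (x, y).
have bm : bounded_measurable m by exact: (bounded_measurable_partial Q Q bF).
have bm1 : bounded_measurable (fun z : n.-tuple V * n.-tuple V => m z.1).
  exact: (bounded_measurable_comp bm).
have m_mix x y : m (mix (pred1 k) x y) = m x.
  by apply: eq_Rintegral => z _; rewrite /F /= mix_mixl.
have bFx x : bounded_measurable (fun y => F (x, y)).
  by apply: bounded_measurable_comp => //; exact: pair1_measurable.
set dev := fun z => (F z - m z.1) ^+ 2.
have bdev : bounded_measurable dev.
  by apply: bounded_measurableX; exact: bounded_measurableB.
have devE : int2 (fun z => (f z.1 - m z.1) ^+ 2) = int2 dev.
  rewrite (int2_swap (pred1 k)) /=; last first.
    by apply: bounded_measurableX; exact: bounded_measurableB.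
  by congr int2; apply/funext => z; rewrite m_mix.
have dev_le : int2 dev <= b.
  rewrite /pair_integral Rintegral_prod// -[leRHS](Rintegral_const Q).
  apply: le_Rintegral => //; try apply: bounded_measurable_integrable.
  - exact: (bounded_measurable_partial Q Q bdev).
  - exact: bounded_measurable_cst.
  move=> x _; have [h] := hb x; apply: le_trans.
  exact: mean_minimizes_sqr_dev.
apply: (@le_trans _ _ (int2 (fun z => 2 * (f z.1 - m z.1) ^+ 2 + 2 * dev z))).
  apply: int2_le => [||z].
  - by apply: bounded_measurableX; exact: bounded_measurableB.
  - by apply: bounded_measurableD; apply: bounded_measurableZ => //;
      apply: bounded_measurableX; exact: bounded_measurableB.
  - rewrite /dev /F; have := sqr_ge0 (f z.1 - m z.1 + (F z - m z.1)).
    by rewrite /F; lra.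
rewrite int2D; try apply: bounded_measurableZ => //; last first.
  by apply: bounded_measurableX; exact: bounded_measurableB.
rewrite !int2Z ?devE//; last first.
  by apply: bounded_measurableX; exact: bounded_measurableB.
by move: dev_le; lra.
Qed.

(** The constant [h] is chosen for each [x] separately: it only has to compete
  with the conditional mean, which is measurable in [x] by Fubini's theorem. *)
Corollary efron_stein_approx (b : 'I_n -> R) :
    (forall k x, exists h,
      \int[Q]_y (f (mix (pred1 k) x y) - h) ^+ 2 <= b k) ->
  \int[Q]_x f x ^+ 2 - (\int[Q]_x f x) ^+ 2 <= 2 * \sum_(k < n) b k.
Proof.
move=> hb; apply: le_trans efron_stein _.
rewrite !mulr_sumr; apply: ler_sum => k _.
by have := resampling_gap_le (hb k); lra.
Qed.

End EfronStein.

(** * Measurability of the resolvent *)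

Section MeasurableMatrices.
Context (R : realType) d (T : measurableType d).

Definition measurable_mx m n (M : T -> 'M[R]_(m, n)) : Prop :=
  forall i j, measurable_fun setT (fun w => M w i j).

Lemma measurable_mx_cst m n (M : 'M[R]_(m, n)) : measurable_mx (fun=> M).
Proof. by move=> i j; exact: measurable_cst. Qed.

Lemma measurable_mx_tr m n (M : T -> 'M[R]_(m, n)) :
  measurable_mx M -> measurable_mx (fun w => (M w)^T).
Proof. by move=> mM i j; under eq_fun do rewrite mxE; exact: mM. Qed.

Lemma measurable_mxD m n (M N : T -> 'M[R]_(m, n)) :
  measurable_mx M -> measurable_mx N -> measurable_mx (fun w => M w + N w).
Proof.
move=> mM mN i j; under eq_fun do rewrite mxE.
exact: measurable_funD.
Qed.

Lemma measurable_mxM m n p (M : T -> 'M[R]_(m, n)) (N : T -> 'M[R]_(n, p)) :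
  measurable_mx M -> measurable_mx N -> measurable_mx (fun w => M w *m N w).
Proof.
move=> mM mN i j; under eq_fun do rewrite mxE.
by apply: measurable_sum => k; exact: measurable_funM.
Qed.

Lemma measurable_det n (M : T -> 'M[R]_n) :
  measurable_mx M -> measurable_fun setT (fun w => \det (M w)).
Proof.
move=> mM; rewrite /determinant.
apply: measurable_sum => s; apply: measurable_funM; first exact: measurable_cst.
by apply: measurable_prod => i _; exact: mM.
Qed.

(** The inverse is not continuous at [0]; writing it as [x * (x ^+ 2)^-1]
  reduces its measurability to that of the real power function. *)
Lemma measurable_funV (f : T -> R) : measurable_fun setT f ->
  measurable_fun setT (fun w => (f w)^-1).
Proof.
move=> mf.
have -> : (fun w => (f w)^-1) = (fun w => f w * (f w ^+ 2) `^ (-1)).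
  apply/funext => w; rewrite powR_inv1 ?sqr_ge0//.
  have [->|f0] := eqVneq (f w) 0; first by rewrite invr0 mul0r.
  by rewrite expr2 invfM mulrA divff// mul1r.
apply: measurable_funM => //.
by apply: (measurableT_comp (measurable_powR _)); exact: measurable_funX.
Qed.

(** Cramer's rule makes each entry a quotient of polynomials in the entries. *)
Lemma measurable_invmx n (M : T -> 'M[R]_n) :
  (forall w, M w \in unitmx) -> measurable_mx M ->
  measurable_mx (fun w => invmx (M w)).
Proof.
move=> uM mM i j.
have -> : (fun w => invmx (M w) i j) =
    (fun w => (\det (M w))^-1 * ((-1) ^+ (j + i) * \det (row' j (col' i (M w))))).
  by apply/funext => w; rewrite /invmx uM !mxE.
apply: measurable_funM; first by apply: measurable_funV; exact: measurable_det.
apply: measurable_funM; first exact: measurable_cst.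
apply: measurable_det => k l.
by under eq_fun do rewrite !mxE; exact: mM.
Qed.

Lemma measurable_gform n p (A : 'M[R]_p) (Y : T -> 'M[R]_(n, p)) a t :
    pdmx A -> 0 < t -> (forall v, t * dot v v <= bform v A v) ->
  measurable_mx Y -> measurable_fun setT (fun w => gform A (Y w) a).
Proof.
move=> pdA t0 leA mY; rewrite /gform /bform.
have mYt := measurable_mx_tr mY.
have mYa : measurable_mx (fun w => (Y w)^T *m a).
  by apply: measurable_mxM => //; exact: measurable_mx_cst.
apply: measurable_mxM => //; apply: measurable_mxM => //.
  exact: measurable_mx_tr.
apply: measurable_invmx => [w|]; first exact/pdmx_unit/gram_pd.
apply: measurable_mxD; last exact: measurable_mx_cst.
exact: measurable_mxM.
Qed.

End MeasurableMatrices.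

(** * Integrals of nonnegative functions, and the variance *)

Section IntegralBounds.
Context (R : realType) d (T : measurableType d) (mu : {measure set T -> \bar R}).

Lemma ge0_integral_leD (f g : T -> R) (a b : R) :
    measurable_fun setT f -> measurable_fun setT g ->
    (forall x, 0 <= f x) -> (forall x, 0 <= g x) ->
    (\int[mu]_x (f x)%:E <= a%:E)%E -> (\int[mu]_x (g x)%:E <= b%:E)%E ->
  (\int[mu]_x (f x + g x)%:E <= (a + b)%:E)%E.
Proof.
move=> mf mg f0 g0 fa gb.
under eq_integral do rewrite EFinD.
rewrite ge0_integralD//; [by rewrite EFinD leeD| | | |].
- by move=> x _; rewrite lee_fin.
- exact/measurable_EFinP.
- by move=> x _; rewrite lee_fin.
- exact/measurable_EFinP.
Qed.

Lemma ge0_integral_leZ (f : T -> R) (c a : R) :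
    measurable_fun setT f -> (forall x, 0 <= f x) -> 0 <= c ->
    (\int[mu]_x (f x)%:E <= a%:E)%E ->
  (\int[mu]_x (c * f x)%:E <= (c * a)%:E)%E.
Proof.
move=> mf f0 c0 fa.
under eq_integral do rewrite EFinM.
rewrite ge0_integralZl_EFin//; first by rewrite EFinM lee_wpmul2l// lee_fin.
- by move=> x _; rewrite lee_fin.
- exact/measurable_EFinP.
Qed.

Lemma ge0_integral_bound_ge0 (f : T -> R) (a : R) : (forall x, 0 <= f x) ->
  (\int[mu]_x (f x)%:E <= a%:E)%E -> 0 <= a.
Proof.
move=> f0; rewrite -lee_fin; apply: le_trans.
by apply: integral_ge0 => x _; rewrite lee_fin.
Qed.

End IntegralBounds.

Lemma variance_bounded_measurable (R : realType) d (T : measurableType d)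
    (P : probability T R) (g : T -> R) : bounded_measurable g ->
  'V_P[g] = (\int[P]_x g x ^+ 2 - (\int[P]_x g x) ^+ 2)%:E.
Proof.
move=> bg; rewrite /variance covariance.unlock expectation.unlock.
rewrite -[fine _]/(\int[P]_x g x); set m := \int[P]_x g x.
have bc r : bounded_measurable (fun _ : T => r) := bounded_measurable_cst _ r.
have iP h : bounded_measurable h -> P.-integrable setT (EFin \o h).
  exact: bounded_measurable_integrable.
have bdev : bounded_measurable (fun x => (g x - m) ^+ 2).
  by apply: bounded_measurableX; exact: bounded_measurableB.
transitivity (\int[P]_x (g x - m) ^+ 2)%:E.
  rewrite /Rintegral fineK; last exact: (integrable_fin_num _ (iP _ bdev)).
  by apply: eq_integral => x _ /=; rewrite expr2.
congr EFin.
transitivity (\int[P]_x (g x ^+ 2 - (2 * m * g x - m ^+ 2))).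
  by apply: eq_Rintegral => x _; ring.
rewrite RintegralB//; last 2 first.
- by apply: iP; exact: bounded_measurableX.
- by apply: iP; apply: bounded_measurableB => //; exact: bounded_measurableZ.
rewrite RintegralB//; last 2 first.
- by apply: iP; exact: bounded_measurableZ.
- exact: iP.
rewrite Rintegral_const RintegralZl//; last exact: iP.
by rewrite -/m; ring.
Qed.

(** * The effect of replacing one observation *)

Section RowReplacement.
Context (R : realType) (n p : nat).
Local Notation V := (p.-tuple (measurableTypeR R)).
Variable r : 'rV[R]_n.

Definition scaled_data (x : n.-tuple V) : 'M[R]_(n, p) :=
  (Num.sqrt n%:R)^-1 *: (diag_mx r *m datamx (tnth x)).

Lemma scaled_dataE x i j :
  scaled_data x i j = r 0 i / Num.sqrt n%:R * tnth (tnth x i) j.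
Proof. by rewrite mxE mul_diag_mx !mxE mulrCA mulrA. Qed.

Lemma gstat_gform (A : 'M[R]_p) (a : 'cV[R]_n) (x : n.-tuple V) :
  gstat (diag_mx r) A a (datamx (tnth x)) = gform A (scaled_data x) a.
Proof.
rewrite /gstat /gform /bform /scaled_data.
set D := diag_mx r; set X := datamx _; set s := (Num.sqrt _)^-1.
have DT : D^T = D by rewrite tr_diag_mx.
have ss : n%:R^-1 = s * s by rewrite /s -invfM -expr2 sqr_sqrtr.
have YT : (s *: (D *m X))^T = s *: (X^T *m D) by rewrite linearZ /= trmx_mul DT.
have SE : n%:R^-1 *: (X^T *m (D *m D) *m X) = (s *: (D *m X))^T *m (s *: (D *m X)).
  by rewrite YT -scalemxAl -scalemxAr scalerA -ss !mulmxA.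
by rewrite SE trmx_mul trmxK YT !mulmxA.
Qed.

Lemma measurable_scaled_data : measurable_mx scaled_data.
Proof.
move=> i j; under eq_fun do rewrite scaled_dataE.
apply: measurable_funM; first exact: measurable_cst.
exact: (measurableT_comp (measurable_tnth j) (measurable_tnth i)).
Qed.

Definition zero_row (k : 'I_n) (Y : 'M[R]_(n, p)) : 'M[R]_(n, p) :=
  \matrix_(i, j) if i == k then 0 else Y i j.

Lemma zero_row_tr_delta k Y : (zero_row k Y)^T *m delta_mx k (0 : 'I_1) = 0.
Proof.
apply/matrixP => i j; rewrite !mxE big1// => l _; rewrite !mxE.
by case: eqP => _; rewrite ?mul0r// ?mulr0.
Qed.

(** This puts the resampling of one observation in the form of a rank one
  update of a matrix that does not depend on that observation. *)
Lemma scaled_data_mix k x y :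
  scaled_data (mix (pred1 k) x y) = zero_row k (scaled_data x) +
    delta_mx k 0 *m ((r 0 k / Num.sqrt n%:R) *: colvec (tnth y k))^T.
Proof.
apply/matrixP => i j; rewrite scaled_dataE [RHS]mxE [zero_row _ _ _ _]mxE.
rewrite scaled_dataE mxE big_ord1 !mxE.
rewrite tnth_mix /= ord1 eqxx andbT.
by case: eqP => [->|_]; rewrite ?mul0r ?mul1r ?add0r ?addr0.
Qed.

End RowReplacement.

(** The increment given by the rank one update splits into
  [a^2 (c - c0) / ((1 + c) (1 + c0))], [2 a b / (1 + c)] and [- b^2 / (1 + c)],
  and the denominators are at least [1]. *)
Lemma update_deviation (R : realFieldType) (a b c c0 : R) : 0 <= c -> 0 <= c0 ->
  ((2 * a * b + a ^+ 2 * c - b ^+ 2) / (1 + c) - a ^+ 2 * (c0 / (1 + c0))) ^+ 2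
  <= 3 * (a ^+ 4 * (c - c0) ^+ 2 + (4 * a ^+ 2 * b ^+ 2 + b ^+ 4)).
Proof.
move=> c_ge0 c0_ge0.
have c1 : 1 + c != 0 by rewrite gt_eqF// ltr_pwDl.
have c01 : 1 + c0 != 0 by rewrite gt_eqF// ltr_pwDl.
pose u := (1 + c)^-1; pose u0 := (1 + c0)^-1.
have -> : (2 * a * b + a ^+ 2 * c - b ^+ 2) / (1 + c) - a ^+ 2 * (c0 / (1 + c0))
    = a ^+ 2 * (c - c0) * (u * u0) + 2 * a * b * u + - b ^+ 2 * u.
  by rewrite /u /u0; field; rewrite c1.
have shrink (z w : R) : 0 <= w <= 1 -> (z * w) ^+ 2 <= z ^+ 2.
  move=> /andP[w0 w1]; rewrite exprMn ler_piMr ?sqr_ge0//.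
  exact: exprn_ile1.
have u01 : 0 <= u <= 1.
  by rewrite invr_ge0 addr_ge0//= invf_le1 ?lerDl// ltr_pwDl.
have u001 : 0 <= u0 <= 1.
  by rewrite invr_ge0 addr_ge0//= invf_le1 ?lerDl// ltr_pwDl.
have uu01 : 0 <= u * u0 <= 1.
  by case/andP: u01 => ? ?; case/andP: u001 => ? ?; rewrite mulr_ge0//= mulr_ile1.
have := shrink (a ^+ 2 * (c - c0)) _ uu01.
have := shrink (2 * a * b) _ u01.
have := shrink (- b ^+ 2) _ u01.
have -> : (a ^+ 2 * (c - c0)) ^+ 2 = a ^+ 4 * (c - c0) ^+ 2 by ring.
have -> : (2 * a * b) ^+ 2 = 4 * a ^+ 2 * b ^+ 2 by ring.
have -> : (- b ^+ 2) ^+ 2 = b ^+ 4 by ring.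
set X := _ * (u * u0); set Y := _ * u; set Z := _ * u.
have := sqr_ge0 (X - Y); have := sqr_ge0 (Y - Z); have := sqr_ge0 (X - Z).
lra.
Qed.

Section Moments.
Context (R : realType) d (T : measurableType d) (P : probability T R) (p : nat).
Variable Y : {RV P >-> p.-tuple (measurableTypeR R)}.

Lemma measurable_colvec_dot (u : 'cV[R]_p) :
  measurable_fun setT (fun v : p.-tuple (measurableTypeR R) => dot (colvec v) u).
Proof.
under eq_fun do rewrite dotE.
apply: measurable_sum => i; apply: measurable_funM; last exact: measurable_cst.
by under eq_fun do rewrite mxE; exact: measurable_tnth.
Qed.

Lemma measurable_colvec_bform (M : 'M[R]_p) :
  measurable_fun setT
    (fun v : p.-tuple (measurableTypeR R) => bform (colvec v) M (colvec v)).
Proof.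
under eq_fun do rewrite bformE dotE.
apply: measurable_sum => i; apply: measurable_funM.
  by under eq_fun do rewrite mxE; exact: measurable_tnth.
under eq_fun do rewrite mxE.
apply: measurable_sum => j; apply: measurable_funM; first exact: measurable_cst.
by under eq_fun do rewrite mxE; exact: measurable_tnth.
Qed.

(** The case [u = 0] cannot be normalised, but then both sides vanish. *)
Lemma linear_moment_scaled bL k (l : R) (u : 'cV[R]_p) : (0 < k)%N ->
  linear_moment_bound Y bL -> bL k = l%:E ->
  (\int[P]_w (`|dot (colvec (Y w)) u| ^+ k)%:E <= (enorm u ^+ k * l)%:E)%E.
Proof.
move=> k0 hL bk.
have [u0|u0] := eqVneq (enorm u) 0.
  rewrite integral0_eq ?u0 ?expr0n ?gtn_eqF ?mul0r// => w _.
  by rewrite (enorm_eq0 u0) /dot mulmx0 mxE normr0 expr0n gtn_eqF.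
have nu : enorm ((enorm u)^-1 *: u) = 1.
  apply/eqP; rewrite -(@eqrXn2 _ 2%N) ?enorm_ge0// expr1n enorm_sqr.
  by rewrite dotZl dotZr -enorm_sqr mulrA -invfM -expr2 mulVf// expf_neq0.
have := hL k k0 _ nu; rewrite bk expectation.unlock => hk.
have -> : (\int[P]_w (`|dot (colvec (Y w)) u| ^+ k)%:E = \int[P]_w (enorm u ^+ k *
    `|((colvec (Y w))^T *m ((enorm u)^-1 *: u)) 0 0| ^+ k)%:E)%E.
  apply: eq_integral => w _; rewrite -/(dot _ _) dotZr normrM exprMn mulrA.
  rewrite -exprMn ger0_norm; last by rewrite invr_ge0 enorm_ge0.
  by rewrite divff// expr1n mul1r.
apply: ge0_integral_leZ hk => [|w|].
- apply: measurable_funX; apply: measurableT_comp => //.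
  exact: (measurableT_comp (measurable_colvec_dot _) (measurable_funP Y)).
- by rewrite exprn_ge0.
- by rewrite exprn_ge0// enorm_ge0.
Qed.

End Moments.

Section RowResampling.
Context (R : realType) d (T : measurableType d) (P : probability T R).
Variables (n p : nat) (Y : {RV P >-> p.-tuple (measurableTypeR R)}).
Variables (bL bQ : nat -> \bar R) (l2 l4 q2 : R).
Hypotheses (hL : linear_moment_bound Y bL) (hQ : quadratic_moment_bound Y bQ).
Hypotheses (bL2 : bL 2%N = l2%:E) (bL4 : bL 4%N = l4%:E) (bQ2 : bQ 2%N = q2%:E).
Hypothesis p_gt0 : (0 < p)%N.

Lemma linear_bound_ge0 k (l : R) : (0 < k)%N -> bL k = l%:E -> 0 <= l.
Proof.
move=> k0 bk; pose e : 'cV[R]_p := delta_mx (Ordinal p_gt0) 0.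
have e1 : enorm e = 1.
  apply/eqP; rewrite -(@eqrXn2 _ 2%N) ?enorm_ge0// expr1n enorm_sqr.
  by rewrite dot_delta mxE !eqxx.
have := hL k0 e1; rewrite bk expectation.unlock; apply: ge0_integral_bound_ge0 => w.
by rewrite exprn_ge0.
Qed.

Lemma quadratic_bound_ge0 (M : 'M[R]_p) : psdmx M -> opnorm M <= 1 -> 0 <= q2.
Proof.
move=> psdM M1; have := hQ (ltn0Sn 1) psdM M1.
rewrite /= bQ2 expectation.unlock; apply: ge0_integral_bound_ge0 => w.
by rewrite exprn_ge0.
Qed.

Variables (A : 'M[R]_p) (t : R) (a : 'cV[R]_n).
Hypotheses (pdA : pdmx A) (t_gt0 : 0 < t).
Hypothesis leA : forall v, t * dot v v <= bform v A v.
Hypothesis a_le1 : dot a a <= 1.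

(** Here [s] is the scale of the resampled row, and [ak] its coefficient in
  [alpha]; the powers of [t^-1] come from the operator norm of the resolvent
  and from the length of the resolvent applied to [Y^T alpha]. *)
Definition resampling_bound (s ak : R) : R :=
  ak ^+ 4 * ((s ^+ 2 / t) ^+ 2 * q2) +
  (4 * ak ^+ 2 * (s ^+ 2 / t * l2) + s ^+ 4 / t ^+ 2 * l4).

(** The approximation [h] replaces the quadratic form [c] of the rank one update
  by its mean [c0] and drops the linear form [b]. What remains is controlled by
  the variance of the quadratic form and the second and fourth moments of
  the linear form in the direction [u], for which [t |u|^2 <= g <= 1]. *)
Lemma row_resampling_moment (Y0 : 'M[R]_(n, p)) (k : 'I_n) (s : R) :
    Y0^T *m delta_mx k (0 : 'I_1) = 0 ->
  0 <= q2 /\ exists h, (\int[P]_w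
    ((gform A (Y0 + delta_mx k 0 *m (s *: colvec (Y w))^T) a - h) ^+ 2)%:E
      <= (3 * resampling_bound s (a k 0))%:E)%E.
Proof.
move=> Y0k; set e := delta_mx k 0 in Y0k *.
have ee : dot e e = 1 by rewrite dot_delta mxE !eqxx.
have ea : dot e a = a k 0 by rewrite dot_delta.
have pdS := gram_pd pdA Y0; have leS := gram_ge leA Y0.
set S := Y0^T *m Y0 + A in pdS leS; pose M := t *: invmx S.
have psdM : psdmx M := psdmx_scaled_resolvent pdS t_gt0 leS.
have M1 : opnorm M <= 1 := opnorm_scaled_resolvent pdS t_gt0 leS.
have q2_ge0 : 0 <= q2 := quadratic_bound_ge0 psdM M1.
split=> //.
pose u := invmx S *m (Y0^T *m a).
have u_le : enorm u ^+ 2 <= t^-1.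
  rewrite enorm_sqr -(ler_pM2l t_gt0) divff ?gt_eqF//.
  apply: le_trans (resolvent_sqr_le pdS leS _) _.
  exact: le_trans (gform_le pdA t_gt0 leA Y0 a) a_le1.
pose q w := bform (colvec (Y w)) M (colvec (Y w)).
pose lin w := dot (colvec (Y w)) u.
pose q0 := fine 'E_P[q]%E.
have q_ge0 w : 0 <= q w by case: psdM => _; exact.
have q0_ge0 : 0 <= q0.
  by apply: fine_ge0; exact: expectation_ge0.
pose c0 := s ^+ 2 / t * q0.
have st_ge0 : 0 <= s ^+ 2 / t by rewrite mulr_ge0 ?sqr_ge0// invr_ge0 ltW.
exists (gform A Y0 a + a k 0 ^+ 2 * (c0 / (1 + c0))).
have mlin : measurable_fun setT lin.
  exact: (measurableT_comp (measurable_colvec_dot u) (measurable_funP Y)).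
have mq : measurable_fun setT q.
  exact: (measurableT_comp (measurable_colvec_bform M) (measurable_funP Y)).
pose g1 w := `|q w - q0| ^+ 2.
pose g2 w := `|lin w| ^+ 2.
pose g4 w := `|lin w| ^+ 4.
have mabs (f : T -> R) j : measurable_fun setT f ->
    measurable_fun setT (fun w => `|f w| ^+ j).
  by move=> mf; apply: measurable_funX; exact: measurableT_comp.
have mg1 : measurable_fun setT g1.
  by apply: mabs; apply: measurable_funB => //; exact: measurable_cst.
have mg2 : measurable_fun setT g2 by exact: mabs.
have mg4 : measurable_fun setT g4 by exact: mabs.
have g1_ge0 w : 0 <= g1 w by rewrite exprn_ge0.
have g2_ge0 w : 0 <= g2 w by rewrite exprn_ge0.
have g4_ge0 w : 0 <= g4 w by rewrite exprn_ge0.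
have i1 : (\int[P]_w (g1 w)%:E <= q2%:E)%E.
  have := hQ (ltn0Sn 1) psdM M1.
  by rewrite /= bQ2 /g1 /q0 expectation.unlock.
have i2 : (\int[P]_w (g2 w)%:E <= (t^-1 * l2)%:E)%E.
  apply: le_trans (linear_moment_scaled u (ltn0Sn 1) hL bL2) _.
  by rewrite lee_fin ler_wpM2r// (linear_bound_ge0 _ bL2).
have i4 : (\int[P]_w (g4 w)%:E <= ((t^-1) ^+ 2 * l4)%:E)%E.
  apply: le_trans (linear_moment_scaled u (ltn0Sn 3) hL bL4) _.
  rewrite lee_fin ler_wpM2r// ?(linear_bound_ge0 _ bL4)//.
  by rewrite -[4%N]/(2 * 2)%N exprM lerXn2r// nnegrE ?sqr_ge0// invr_ge0 ltW.
pose k1 := a k 0 ^+ 4 * (s ^+ 2 / t) ^+ 2.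
pose k2 := 4 * a k 0 ^+ 2 * s ^+ 2.
pose k4 := s ^+ 4.
have k1_ge0 : 0 <= k1 by rewrite mulr_ge0 ?sqr_ge0 ?exprn_even_ge0.
have k2_ge0 : 0 <= k2.
  by apply: mulr_ge0 (sqr_ge0 _); apply: mulr_ge0 (sqr_ge0 _); exact: ler0n.
have k4_ge0 : 0 <= k4 by rewrite exprn_even_ge0.
have mZ c (f : T -> R) : measurable_fun setT f ->
    measurable_fun setT (fun w => c * f w).
  by move=> mf; apply: measurable_funM => //; exact: measurable_cst.
pose G w := 3 * (k1 * g1 w + (k2 * g2 w + k4 * g4 w)).
have mG24 : measurable_fun setT (fun w => k2 * g2 w + k4 * g4 w).
  by apply: measurable_funD; exact: mZ.
have G24_ge0 w : 0 <= k2 * g2 w + k4 * g4 w by rewrite addr_ge0// mulr_ge0.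
have mG : measurable_fun setT G.
  by apply: (mZ); apply: measurable_funD => //; exact: mZ.
apply: (@le_trans _ _ (\int[P]_w (G w)%:E)%E); last first.
  have -> : resampling_bound s (a k 0) =
      k1 * q2 + (k2 * (t^-1 * l2) + k4 * ((t^-1) ^+ 2 * l4)).
    by rewrite /resampling_bound /k1 /k2 /k4; field; rewrite gt_eqF.
  apply: ge0_integral_leZ => // [|w|].
  - by apply: measurable_funD => //; exact: mZ.
  - by rewrite addr_ge0// mulr_ge0.
  apply: ge0_integral_leD => // [|w||].
  - exact: mZ.
  - by rewrite mulr_ge0.
  - exact: ge0_integral_leZ.
  apply: ge0_integral_leD => // [||w|w||].
  - exact: mZ.
  - exact: mZ.
  - by rewrite mulr_ge0.
  - by rewrite mulr_ge0.
  - exact: ge0_integral_leZ.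
  - exact: ge0_integral_leZ.
have devG w : (gform A (Y0 + e *m (s *: colvec (Y w))^T) a -
    (gform A Y0 a + a k 0 ^+ 2 * (c0 / (1 + c0)))) ^+ 2 <= G w.
  rewrite (gform_rank_one_update pdA t_gt0 leA (s *: colvec (Y w)) a Y0k ee).
  rewrite -/S -/u ea dotZl -/(lin w).
  have -> : bform (s *: colvec (Y w)) (invmx S) (s *: colvec (Y w)) =
      s ^+ 2 / t * q w.
    rewrite /q /M !bformE -scalemxAl -scalemxAr !(dotZl, dotZr).
    by field; rewrite gt_eqF.
  have -> : G w = 3 * (a k 0 ^+ 4 * (s ^+ 2 / t * q w - c0) ^+ 2 +
      (4 * a k 0 ^+ 2 * (s * lin w) ^+ 2 + (s * lin w) ^+ 4)).
    rewrite /G /g1 /g2 /g4 /k1 /k2 /k4 /c0.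
    rewrite real_normK ?num_real// -[4%N]/(2 * 2)%N !exprM.
    rewrite real_normK ?num_real//; ring.
  rewrite opprD addrACA subrr add0r.
  by apply: update_deviation; rewrite mulr_ge0.
apply: ge0_le_integral => //.
- by move=> w _; rewrite lee_fin sqr_ge0.
- apply/measurable_EFinP; apply: measurable_funX; apply: measurable_funB.
    apply: (measurable_gform _ pdA t_gt0 leA).
    apply: measurable_mxD; first exact: measurable_mx_cst.
    apply: measurable_mxM; first exact: measurable_mx_cst.
    apply: measurable_mx_tr => i j; under eq_fun do rewrite !mxE.
    by apply: (mZ); exact: (measurableT_comp (measurable_tnth i) (measurable_funP Y)).
  exact: measurable_cst.
- exact/measurable_EFinP.
- by move=> w _; rewrite lee_fin.
Qed.

End RowResampling.

(** * The variance bound *)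

Section JointLaw.
Context (R : realType) d (T : measurableType d) (P : probability T R).
Context d' (V : measurableType d') (n : nat).
Variable X : 'I_n -> {RV P >-> V}.

Definition joint (w : T) : n.-tuple V := [tuple X i w | i < n].

Lemma tnth_joint w i : tnth (joint w) i = X i w.
Proof. exact: tnth_mktuple. Qed.

Lemma measurable_joint : measurable_fun setT joint.
Proof.
apply/measurable_fun_tnthP => i.
have -> : (fun x => tnth x i) \o joint = X i.
  by apply/funext => w /=; rewrite tnth_joint.
exact: measurable_funP.
Qed.

HB.instance Definition _ := isMeasurableFun.Build _ _ _ _ joint measurable_joint.

Lemma joint_coord_independent :
  independent_family X -> coord_independent (distribution P joint).
Proof.
move=> indX B mB; have := indX finset.setT B mB.
rewrite (_ : \bigcap_(i in _) _ = joint @^-1` box B); last first.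
  apply/seteqP; split=> w /= wB i.
    by rewrite tnth_joint; apply: wB; rewrite /= finset.in_setT.
  by move=> _; have := wB i; rewrite tnth_joint.
move=> PB; apply: etrans PB _; apply: eq_big => [i|i _].
  by rewrite finset.in_setT.
rewrite -[RHS]/(P (joint @^-1` [set x | B i (tnth x i)])).
congr (P _); apply/seteqP; split=> w /=; by rewrite tnth_joint.
Qed.

Lemma Rintegral_joint (F : n.-tuple V -> R) : bounded_measurable F ->
  \int[distribution P joint]_y F y = \int[P]_w F (joint w).
Proof.
move=> bF; congr fine; rewrite integral_distribution//.
  by apply/measurable_EFinP; exact: bF.1.
apply: (@bounded_measurable_integrable _ _ _ _ (F \o joint)).
exact: (bounded_measurable_comp bF measurable_joint).
Qed.

End JointLaw.

Theorem theorem3p4 (R : realType) :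
  exists K : R, 0 < K /\
  forall (cmin cmax : R), 0 < cmin ->
  forall (n p : nat), (0 < n)%N -> (0 < p)%N ->
    cmin <= p%:R / n%:R <= cmax ->
  forall (d : measure_display) (T : measurableType d) (P : probability T R)
    (X : 'I_n -> {RV P >-> p.-tuple (measurableTypeR R)})
    (Sigma : 'I_n -> 'M[R]_p)
    (bL bQ2 : nat -> 'I_n -> \bar R),
    independent_family X ->
    identically_distributed X ->
    (forall i, centered_with_cov (X i) (Sigma i)) ->
    (forall i, linear_moment_bound (X i) (fun k => bL k i)) ->
    (forall i, quadratic_moment_bound (X i) (fun k => bQ2 k i)) ->
    (forall i, [/\ bL 2%N i \is a fin_num, bL 4%N i \is a fin_num
                 & bQ2 2%N i \is a fin_num]) ->
    (forall i k, (1 <= k)%N -> (bL k i <= sqrte (bL (2 * k)%N i))%E) ->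
  forall (r : 'rV[R]_n) (A : 'M[R]_p) (t : R) (alpha : 'cV[R]_n),
    (forall i, 0 < r 0 i) ->
    pdmx A -> 0 < t -> loewner_le t%:M A ->
    enorm alpha = 1 ->
    ('V_P[fun w => gstat (diag_mx r) A alpha (datamx (fun i => X i w))] <=
     K%:E * \sum_(i < n)
       mine
         ((alpha i 0 ^+ 4 * (r 0 i ^+ 4 / n%:R))%R%:E
              * (bQ2 2%N i * (n%:R * t ^+ 2)^-1%R%:E)
          + (r 0 i ^+ 4 / n%:R ^+ 2)%R%:E * bL 4%N i * (t ^+ 2)^-1%R%:E
          + (alpha i 0 ^+ 2 * (r 0 i ^+ 2 / n%:R))%R%:E * (bL 2%N i * t^-1%R%:E))
         1)%E.
Proof.
(* [24 = 2 * 12]: the factor [2] of Efron-Stein, and [3 * 4] from the square of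
   a sum of three terms and the coefficient [(2 a b)^2 = 4 a^2 b^2] *)
exists 24; split=> // cmin cmax _ n p n0 p0 _ d T P X Sigma bL bQ2 indX _ _.
move=> hL hQ hfin _ r A t alpha _ pdA t0 leA' alpha1.
have leA := loewner_scalar_le leA'.
have aa : dot alpha alpha = 1 by rewrite -enorm_sqr alpha1 expr1n.
pose l2 i := fine (bL 2%N i); pose l4 i := fine (bL 4%N i).
pose q2 i := fine (bQ2 2%N i).
have bL2 i : bL 2%N i = (l2 i)%:E by have [? _ _] := hfin i; rewrite /l2 fineK.
have bL4 i : bL 4%N i = (l4 i)%:E by have [_ ? _] := hfin i; rewrite /l4 fineK.
have bQ2E i : bQ2 2%N i = (q2 i)%:E by have [_ _ ?] := hfin i; rewrite /q2 fineK.
pose f (x : n.-tuple (p.-tuple (measurableTypeR R))) :=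
  gform A (scaled_data r x) alpha.
have f_ge0 x : 0 <= f x by exact: (gform_ge0 pdA t0 leA).
have f_le1 x : f x <= 1 by rewrite -aa; exact: (gform_le pdA t0 leA).
have bf : bounded_measurable f.
  split; last by exists 1 => x; rewrite ger0_norm.
  by apply: (measurable_gform _ pdA t0 leA); exact: measurable_scaled_data.
have -> : (fun w => gstat (diag_mx r) A alpha (datamx (fun i => X i w))) =
    f \o joint X.
  apply/funext => w /=; rewrite /f -gstat_gform; congr gstat.
  by apply/matrixP => i j; rewrite !mxE tnth_joint.
have bfX : bounded_measurable (f \o joint X).
  exact: (bounded_measurable_comp bf (measurable_joint X)).
rewrite variance_bounded_measurable// -[X in (_ - X ^+ 2)](Rintegral_joint X bf).
rewrite -(Rintegral_joint X (bounded_measurableX 2 bf)).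
pose s i := r 0 i / Num.sqrt n%:R.
pose B i := alpha i 0 ^+ 4 * (r 0 i ^+ 4 / n%:R) * (q2 i * (n%:R * t ^+ 2)^-1) +
  r 0 i ^+ 4 / n%:R ^+ 2 * l4 i * (t ^+ 2)^-1 +
  alpha i 0 ^+ 2 * (r 0 i ^+ 2 / n%:R) * (l2 i * t^-1).
under eq_bigr do rewrite bL2 bL4 bQ2E -!EFinM -!EFinD -EFin_min -/(B _).
rewrite sumEFin -EFinM lee_fin.
have -> : 24 * \sum_(i < n) Num.min (B i) 1 =
    2 * \sum_(i < n) 12 * Num.min (B i) 1 by rewrite -mulr_sumr; ring.
have nR0 : n%:R != 0 :> R by rewrite pnatr_eq0 -lt0n.
apply: (efron_stein_approx (joint_coord_independent indX) bf) => k x.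
have [l2_ge0 l4_ge0] : 0 <= l2 k /\ 0 <= l4 k.
  split; first exact: (linear_bound_ge0 (hL k) p0 (ltn0Sn 1) (bL2 k)).
  exact: (linear_bound_ge0 (hL k) p0 (ltn0Sn 3) (bL4 k)).
have aa1 : dot alpha alpha <= 1 by rewrite aa.
have [q2_ge0 [h hP]] := row_resampling_moment (hL k) (hQ k) (bL2 k) (bL4 k)
  (bQ2E k) p0 pdA t0 leA aa1 (s k) (zero_row_tr_delta k (scaled_data r x)).
have bfk c : bounded_measurable (fun y => (f (mix (pred1 k) x y) - c) ^+ 2).
  apply: bounded_measurableX; apply: bounded_measurableB.
    apply: (bounded_measurable_comp bf); apply: measurable_mix => //.
  exact: bounded_measurable_cst.
have [B1|B1] := leP (B k) 1; last first.
  (* the range [[0, 1]] of the statistic gives the truncation at [1] *)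
  exists 0; rewrite mulr1.
  apply: (@le_trans _ _ (\int[distribution P (joint X)]_y (1 : R))).
    apply: le_Rintegral => //; try apply: bounded_measurable_integrable => //.
      exact: bounded_measurable_cst.
    by move=> y _; rewrite subr0 exprn_ile1.
  by rewrite Rintegral_const ler1n.
exists h.
rewrite (Rintegral_joint X (bfk h)) -lee_fin /Rintegral fineK; last first.
  apply: integrable_fin_num => //.
  apply: (@bounded_measurable_integrable _ _ _ _
    (fun w => (f (mix (pred1 k) x (joint X w)) - h) ^+ 2)).
  exact: (bounded_measurable_comp (bfk h) (measurable_joint X)).
have s2 : s k ^+ 2 = r 0 k ^+ 2 / n%:R.
  by rewrite /s expr_div_n sqr_sqrtr.
have t_neq0 : t != 0 by rewrite gt_eqF.
have T1 : alpha k 0 ^+ 4 * (r 0 k ^+ 4 / n%:R) * (q2 k * (n%:R * t ^+ 2)^-1) =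
    alpha k 0 ^+ 4 * ((s k ^+ 2 / t) ^+ 2 * q2 k).
  by rewrite s2; field; rewrite t_neq0 nR0.
have T2 : r 0 k ^+ 4 / n%:R ^+ 2 * l4 k * (t ^+ 2)^-1 =
    s k ^+ 4 / t ^+ 2 * l4 k.
  by rewrite -[4%N]/(2 * 2)%N (exprM (s k)) s2; field; rewrite t_neq0 nR0.
have T3 : alpha k 0 ^+ 2 * (r 0 k ^+ 2 / n%:R) * (l2 k * t^-1) =
    alpha k 0 ^+ 2 * (s k ^+ 2 / t * l2 k).
  by rewrite s2; field; rewrite t_neq0 nR0.
apply: (@le_trans _ _
    (3 * resampling_bound (l2 k) (l4 k) (q2 k) t (s k) (alpha k 0))%:E).
  apply: le_trans hP; rewrite le_eqVlt; apply/orP; left; apply/eqP.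
  by apply: eq_integral => w _; rewrite /f scaled_data_mix tnth_joint.
rewrite lee_fin /B T1 T2 T3 /resampling_bound.
have pow4_ge0 (z : R) : 0 <= z ^+ 4 by rewrite exprn_even_ge0.
have h1 : 0 <= alpha k 0 ^+ 4 * ((s k ^+ 2 / t) ^+ 2 * q2 k).
  apply: mulr_ge0; first exact: pow4_ge0.
  by apply: mulr_ge0 => //; exact: sqr_ge0.
have h2 : 0 <= s k ^+ 4 / t ^+ 2 * l4 k.
  apply: mulr_ge0 => //; apply: mulr_ge0; first exact: pow4_ge0.
  by rewrite invr_ge0 sqr_ge0.
lra.
Qed.
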